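(* There are $\mathfrak{c}$ many Luzin families on $\omega$ whose $\Psi$-spaces are pairwise non-homeomorphic.
   Context: An almost disjoint (AD) family on $\omega$ is a family of infinite subsets of $\omega$ any two distinct members of which have finite intersection. An AD family $\mathcal{A}$ is Luzin if it can be enumerated as $\mathcal{A} = \langle A_\alpha : \alpha < \omega_1 \rangle$ so that for every $\alpha < \omega_1$ and every $n \in \omega$ the set $\{\beta < \alpha : A_\alpha \cap A_\beta \subseteq n\}$ is finite. For an AD family $\mathcal{A}$, the space $\Psi(\mathcal{A})$ has underlying set $\omega \cup \mathcal{A}$; points of $\omega$ are isolated, and basic neighborhoods of a point $x \in \mathcal{A}$ are the sets $\{x\} \cup (x \setminus F)$ with $F \subseteq \omega$ finite. *)

(* Defs.v *)
From Stdlib Require Import List Arith.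
Import ListNotations.

Definition subset_nat := nat -> Prop.

Definition finite_nat (S : subset_nat) : Prop :=
  exists l : list nat, forall m, S m -> In m l.

Definition infinite_nat (S : subset_nat) : Prop := ~ finite_nat S.

Definition AD (A : subset_nat -> Prop) : Prop :=
  (forall x, A x -> infinite_nat x) /\
  (forall x y, A x -> A y -> x <> y -> finite_nat (fun m => x m /\ y m)).

Definition is_omega1 (I : Type) (lt : I -> I -> Prop) : Prop :=
  (forall a, ~ lt a a) /\
  (forall a b c, lt a b -> lt b c -> lt a c) /\
  (forall a b, lt a b \/ a = b \/ lt b a) /\
  well_founded lt /\
  (~ exists f : I -> nat, forall a b, f a = f b -> a = b) /\
  (forall a, exists f : I -> nat,
      forall b c, lt b a -> lt c a -> f b = f c -> b = c).

Definition Luzin (A : subset_nat -> Prop) : Prop :=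
  AD A /\
  exists (I : Type) (lt : I -> I -> Prop) (e : I -> subset_nat),
    is_omega1 I lt /\
    (forall a b, e a = e b -> a = b) /\
    (forall x, A x <-> exists a, e a = x) /\
    (forall (a : I) (n : nat),
       exists l : list I, forall b,
         lt b a -> (forall m, e a m -> e b m -> m < n) -> In b l).

Definition Psi (A : subset_nat -> Prop) : Type :=
  { p : nat + subset_nat | match p with inl _ => True | inr x => A x end }.

Definition Psi_nat (A : subset_nat -> Prop) (m : nat) : Psi A :=
  exist _ (inl m) I.

(* Open sets of Psi(A): points of omega are isolated, and a basic
   neighbourhood of x in A is {x} ∪ (x \ F), F finite. *)
Definition Psi_open (A : subset_nat -> Prop) (U : Psi A -> Prop) : Prop :=
  forall p : Psi A, U p ->
    forall x, proj1_sig p = inr x ->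
      exists F : list nat, forall m, x m -> ~ In m F -> U (Psi_nat A m).

Definition Psi_continuous (A B : subset_nat -> Prop) (f : Psi A -> Psi B) : Prop :=
  forall V : Psi B -> Prop, Psi_open B V -> Psi_open A (fun p => V (f p)).

Definition Psi_homeomorphic (A B : subset_nat -> Prop) : Prop :=
  exists (f : Psi A -> Psi B) (g : Psi B -> Psi A),
    (forall p, g (f p) = p) /\ (forall q, f (g q) = q) /\
    Psi_continuous A B f /\ Psi_continuous B A g.

(* Main.v *)
(** Build the families by the usual transfinite recursion, controlling sizes: for an
    unbounded set [S] of naturals, [A_a] is built so that all [|A_a /\ A_b|], [b < a],
    lie in [S] and only finitely many of them are at most any given [N].

    A homeomorphism of Psi-spaces is a bijection [h] of omega carrying each [A_a] to a
    member of the other family up to a finite set.  On an uncountable set of indices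
    these finite errors are the same, so there the sizes of intersections in the two
    families differ by a constant, and they are unbounded.  Hence sets [S_i] such that
    any translates of [S_i] and [S_j], [i <> j], have finite intersection yield
    non-homeomorphic spaces; sets of powers of two coded by the branches of the binary
    tree provide continuum many such [S_i]. *)

From Stdlib Require Import List Arith Lia Cantor FinFun Wellfounded.
From Stdlib Require Import Classical ClassicalEpsilon.
From Stdlib Require Import FunctionalExtensionality ProofIrrelevance.
From mathcomp Require ssrbool boolp wochoice.
Require Import Defs.
Import ListNotations.

(** * Cardinalities of finite sets of natural numbers *)

Definition has_card (X : subset_nat) (n : nat) : Prop :=
  exists l, NoDup l /\ (forall m, In m l <-> X m) /\ length l = n.

Lemma has_card_finite X n : has_card X n -> finite_nat X.
Proof. intros (l & _ & H & _). exists l. intros m; apply H. Qed.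

Lemma list_separation {T : Type} (P : T -> Prop) (l : list T) :
  exists l', NoDup l' /\ forall x, In x l' <-> In x l /\ P x.
Proof.
induction l as [|a l (l' & Hnd & Hl')].
- exists []; split; [constructor|]. simpl; tauto.
- destruct (classic (P a /\ ~ In a l')) as [[HP Hn]|Hn].
  + exists (a :: l'); split; [now constructor|].
    intros x; simpl; rewrite Hl'. intuition (subst; auto).
  + exists l'; split; auto. intros x; rewrite Hl'; simpl. split; [tauto|].
    intros [[->|Hx] HP]; [|tauto].
    apply Hl'. destruct (classic (In x l')); tauto.
Qed.

Lemma finite_has_card X : finite_nat X -> exists n, has_card X n.
Proof.
intros [l Hl]. destruct (list_separation X l) as (l' & Hnd & Hl').
exists (length l'), l'. repeat split; auto; intros Hm; apply Hl' in Hm || apply Hl'; firstorder.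
Qed.

Lemma finite_subset (X Y : subset_nat) :
  (forall m, X m -> Y m) -> finite_nat Y -> finite_nat X.
Proof. intros H [l Hl]; exists l; auto. Qed.

Lemma finite_union X Y :
  finite_nat X -> finite_nat Y -> finite_nat (fun m => X m \/ Y m).
Proof.
intros [l Hl] [l' Hl']. exists (l ++ l'). intros m [H|H]; apply in_or_app; auto.
Qed.

Lemma finite_bounded_union (E : nat -> subset_nat) k :
  (forall j, j < k -> finite_nat (E j)) ->
  finite_nat (fun m => exists j, j < k /\ E j m).
Proof.
induction k as [|k IH]; intros H.
- exists []. intros m (j & Hj & _); lia.
- apply finite_subset with (fun m => (exists j, j < k /\ E j m) \/ E k m).
  + intros m (j & Hj & Hm). destruct (Nat.eq_dec j k) as [->|]; [now right|].
    left; exists j; split; auto; lia.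
  + apply finite_union; auto.
Qed.

Lemma has_card_ext (X Y : subset_nat) n :
  (forall m, X m <-> Y m) -> has_card X n -> has_card Y n.
Proof.
intros H (l & H1 & H2 & H3). exists l; repeat split; auto; intros; firstorder.
Qed.

Lemma has_card_le (X Y : subset_nat) a b :
  (forall m, X m -> Y m) -> has_card X a -> has_card Y b -> a <= b.
Proof.
intros H (l & N1 & H1 & <-) (l' & N2 & H2 & <-).
apply NoDup_incl_length; auto. intros m Hm. apply H2, H, H1, Hm.
Qed.

Lemma has_card_unique X a b : has_card X a -> has_card X b -> a = b.
Proof. intros Ha Hb. apply Nat.le_antisymm; eapply has_card_le; eauto. Qed.

Lemma has_card_union (X Y : subset_nat) a b :
  (forall m, X m -> Y m -> False) -> has_card X a -> has_card Y b ->
  has_card (fun m => X m \/ Y m) (a + b).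
Proof.
intros H (l & N1 & H1 & <-) (l' & N2 & H2 & <-).
exists (l ++ l'); repeat split.
- apply NoDup_app; auto. intros m Hm Hm'. apply (H m); firstorder.
- intros Hm. apply in_app_or in Hm. firstorder.
- intros Hm. apply in_or_app. firstorder.
- apply length_app.
Qed.

Lemma has_card_preimage (h g : nat -> nat) (X : subset_nat) n :
  (forall m, g (h m) = m) -> (forall m, h (g m) = m) ->
  has_card X n -> has_card (fun m => X (h m)) n.
Proof.
intros Hgh Hhg (l & N1 & H1 & <-).
exists (map g l); repeat split.
- apply Injective_map_NoDup; auto. intros x y Hxy. congruence.
- intros Hm. apply in_map_iff in Hm. destruct Hm as (y & <- & Hy).
  apply H1. now rewrite Hhg.
- intros Hm. apply in_map_iff. exists (h m); split; auto. now apply H1.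
- apply length_map.
Qed.

Lemma has_card_lt n : has_card (fun m => m < n) n.
Proof.
exists (seq 0 n); repeat split; try apply seq_NoDup; try apply length_seq;
  intros H; apply in_seq in H || apply in_seq; lia.
Qed.

Lemma infinite_diff (X Y : subset_nat) :
  infinite_nat X -> finite_nat (fun m => X m /\ Y m) ->
  infinite_nat (fun m => X m /\ ~ Y m).
Proof.
intros HX HY HD. apply HX.
eapply finite_subset; [|exact (finite_union _ _ HY HD)].
intros m Hm; simpl. destruct (classic (Y m)); tauto.
Qed.

Lemma infinite_inhabited_outside (X : subset_nat) (l : list nat) :
  infinite_nat X -> exists m, X m /\ ~ In m l.
Proof.
intros HX. apply NNPP; intros H. apply HX. exists l. intros m Hm.
apply NNPP; intros Hl. apply H; eauto.
Qed.

Lemma infinite_sublist (X : subset_nat) n :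
  infinite_nat X -> exists l, NoDup l /\ length l = n /\ forall m, In m l -> X m.
Proof.
intros HX. induction n as [|n (l & N & L & H)].
- exists []; repeat split; [constructor|]. simpl; tauto.
- destruct (infinite_inhabited_outside X l HX) as (m & Hm & Hl).
  exists (m :: l); repeat split; [now constructor|simpl; congruence|].
  intros x [<-|Hx]; auto.
Qed.

Lemma infinite_of_large_subsets (X : subset_nat) :
  (forall N, exists (Y : subset_nat) s, (forall m, Y m -> X m) /\ has_card Y s /\ N <= s) ->
  infinite_nat X.
Proof.
intros H HX. destruct (finite_has_card X HX) as [n Hn].
destruct (H (S n)) as (Y & s & HYX & HY & Hs).
pose proof (has_card_le _ _ _ _ HYX HY Hn). lia.
Qed.

(** * The first uncountable ordinal *)

Section InitialSegment.

Variables (T : Type) (R : T -> T -> Prop).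
(** This is the form in which the well-ordering principle is applied below. The axioms of a strict
    well-order follow by taking minima of sets with at most three elements, and of the set of
    inaccessible points. *)
Hypothesis Rmin : forall P : T -> Prop, (exists x, P x) ->
  exists ! z, P z /\ forall x, P x -> R z x.

Let slt a b := R a b /\ a <> b.

Lemma minimum_refl a : R a a.
Proof.
destruct (Rmin (fun x => x = a)) as (z & [-> Hz] & _); eauto.
Qed.

Lemma minimum_antisym a b : R a b -> R b a -> a = b.
Proof.
intros Hab Hba.
destruct (Rmin (fun x => x = a \/ x = b)) as (z & _ & Hu); eauto.
transitivity z; [symmetry|]; apply Hu; split; auto;
  intros x [->| ->]; auto using minimum_refl.
Qed.

Lemma slt_trans a b c : slt a b -> slt b c -> slt a c.
Proof.
intros [Hab Nab] [Hbc Nbc].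
destruct (Rmin (fun x => x = a \/ x = b \/ x = c)) as (z & [Hz Hm] & _); eauto.
destruct Hz as [->| [->| ->]].
- split; auto. intros ->. apply Nab, minimum_antisym; auto.
- exfalso. apply Nab, minimum_antisym; auto.
- exfalso. apply Nbc, minimum_antisym; auto.
Qed.

Lemma slt_total a b : slt a b \/ a = b \/ slt b a.
Proof.
unfold slt. destruct (Rmin (fun x => x = a \/ x = b)) as (z & [Hz Hm] & _); eauto.
destruct (classic (a = b)) as [|Hab]; auto.
destruct Hz as [->| ->]; [left|right; right]; auto.
Qed.

Lemma slt_wf : well_founded slt.
Proof.
intros a. apply NNPP; intros Ha.
destruct (Rmin (fun x => ~ Acc slt x)) as (z & [Hz Hm] & _); eauto.
apply Hz. constructor. intros y [Hy Ny]. apply NNPP; intros Hy'.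
apply Ny, minimum_antisym; auto.
Qed.

(** If some point has uncountably many predecessors, the initial segment below the least such point
    is a copy of the first uncountable ordinal. Otherwise the whole order is one. *)
Lemma uncountable_initial_omega1 :
  (~ exists f : T -> nat, forall a b, f a = f b -> a = b) ->
  exists (I : Type) (lt : I -> I -> Prop), is_omega1 I lt.
Proof.
intros HT.
set (C := fun a => exists f : T -> nat,
            forall b c, slt b a -> slt c a -> f b = f c -> b = c).
destruct (classic (exists a, ~ C a)) as [Ha|Ha].
- destruct (Rmin _ Ha) as (a & [Hna Hmin] & _).
  assert (Hinj : forall x y : {b | slt b a}, proj1_sig x = proj1_sig y -> x = y).
  { intros [x Hx] [y Hy]; simpl; intros ->. f_equal; apply proof_irrelevance. }
  exists {b | slt b a}, (fun x y => slt (proj1_sig x) (proj1_sig y)).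
  refine (conj _ (conj _ (conj _ (conj _ (conj _ _))))).
  + intros x [_ Hx]; auto.
  + intros x y z; apply slt_trans.
  + intros x y. destruct (slt_total (proj1_sig x) (proj1_sig y)) as [H|[H|H]]; auto.
  + apply Inverse_Image.wf_inverse_image, slt_wf.
  + intros [f Hf]. apply Hna.
    (* Injectivity is required only below [a], so the default value 0 elsewhere is harmless. *)
    exists (fun b => match excluded_middle_informative (slt b a) with
                     | left H => f (exist _ b H) | right _ => 0 end).
    intros b c Hb Hc.
    destruct (excluded_middle_informative (slt b a)); [|tauto].
    destruct (excluded_middle_informative (slt c a)); [|tauto].
    intros E%Hf. now injection E.
  + intros [x Hx]. assert (Cx : C x).
    { apply NNPP; intros Hn. apply Hmin in Hn. destruct Hx as [Hx Nx].
      apply Nx, minimum_antisym; auto. }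
    destruct Cx as [f Hf]. exists (fun y => f (proj1_sig y)).
    simpl. intros b c Hb Hc E. apply Hinj, Hf; auto.
- exists T, slt. refine (conj _ (conj _ (conj _ (conj _ (conj _ _))))).
  + intros a [_ H]; auto.
  + exact slt_trans.
  + apply slt_total.
  + apply slt_wf.
  + exact HT.
  + intros a. apply NNPP; intros H; apply Ha; exists a; exact H.
Qed.

End InitialSegment.

Lemma cantor_nat : ~ exists f : subset_nat -> nat, forall a b, f a = f b -> a = b.
Proof.
intros [f Hf]. set (D := fun n => exists X, f X = n /\ ~ X n).
assert (H : ~ D (f D)).
{ intros HD. pose proof HD as (X & E & HX). apply Hf in E; subst X. auto. }
apply H. exists D. auto.
Qed.

Lemma omega1_exists : exists (I : Type) (lt : I -> I -> Prop), is_omega1 I lt.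
Proof.
destruct (wochoice.well_ordering_principle (boolp.boolp_classicType__canonical__eqtype_Equality subset_nat)
   : {R : ssrbool.rel (boolp.classicType subset_nat) | wochoice.well_order R}) as [R HR].
apply (uncountable_initial_omega1 subset_nat (fun a b => R a b = true)).
- intros P [x Hx].
  destruct (HR (fun x => boolp.asbool (P x))) as (z & [Hz Hm] & Hu).
  + exists x. apply boolp.asboolT, Hx.
  + exists z. repeat split.
    * apply boolp.asboolW, Hz.
    * intros y Hy. apply Hm. apply boolp.asboolT, Hy.
    * intros y [Hy Hy']. apply Hu. split.
      -- apply boolp.asboolT, Hy.
      -- intros t Ht. apply Hy', boolp.asboolW, Ht.
- exact cantor_nat.
Qed.

(** * Construction of Luzin families with prescribed intersection sizes *)

Definition unbounded (S : nat -> Prop) : Prop := forall N, exists s, S s /\ N <= s.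

Section Transversal.

Variables (S : nat -> Prop) (E : nat -> subset_nat).
Hypothesis HS : unbounded S.
Hypothesis HE : forall j k, j <> k -> finite_nat (fun m => E j m /\ E k m).

(** [G] holds the points chosen so far, [g] of them in [E k]. By almost disjointness, [E k] stays
    infinite after removing [G] and all earlier [E j], and [s - g] fresh points from there bring the
    count to [s]. *)
Lemma transversal_step k (G : list nat) : exists F : list nat,
  (forall m j, In m F -> j < k -> ~ E j m) /\
  (infinite_nat (E k) ->
   exists s, S s /\ k <= s /\ has_card (fun m => (In m F \/ In m G) /\ E k m) s).
Proof.
destruct (classic (infinite_nat (E k))) as [Hk|Hk].
2: { exists []; split; simpl; tauto. }
assert (HG : finite_nat (fun m => In m G /\ E k m)) by (exists G; tauto).
destruct (finite_has_card _ HG) as [g Hg].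
(* The bound [k + g] secures both [k <= s] and that [s - g] is a genuine difference. *)
destruct (HS (k + g)) as (s & Hs & Hkg).
set (Y := fun m => (exists j, j < k /\ E j m) \/ In m G).
assert (HY : infinite_nat (fun m => E k m /\ ~ Y m)).
{ apply infinite_diff; auto.
  apply finite_subset with
    (fun m => (exists j, j < k /\ (E j m /\ E k m)) \/ (In m G /\ E k m)).
  - intros m [Hm [(j & Hj & Hjm)|Hm']]; [left; exists j|right]; auto.
  - apply finite_union; auto. apply (finite_bounded_union (fun j m => E j m /\ E k m)).
    intros j Hj. apply HE. lia. }
destruct (infinite_sublist _ (s - g) HY) as (F & NF & LF & HF).
exists F; split.
- intros m j Hm Hj Hjm. apply HF in Hm. apply Hm. left; eauto.
- intros _. exists s; split; [auto|split; [lia|]].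
  replace s with ((s - g) + g) by lia.
  apply has_card_ext with (fun m => In m F \/ (In m G /\ E k m)).
  + intros m; split; [intros [Hm|Hm]|tauto]; [|tauto].
    split; [auto|]. now apply HF in Hm.
  + apply has_card_union; [|exists F; tauto|auto].
    intros m Hm [Hm' _]. apply HF in Hm. apply Hm. now right.
Qed.

(* The points added at stage [k] avoid [E j] for all [j < k], so stage [k]
   settles the cardinality of the intersection with [E k] once and for all. *)
Lemma transversal : exists A : subset_nat, forall k, infinite_nat (E k) ->
  exists s, S s /\ k <= s /\ has_card (fun m => A m /\ E k m) s.
Proof.
destruct (boolp.choice (fun p : nat * list nat => transversal_step (fst p) (snd p)))
  as [Fn HF].
set (G := fix G k := match k with 0 => [] | Datatypes.S k => Fn (k, G k) ++ G k end).
(* After stage [k], no further point of [E k] enters. *)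
assert (HG : forall k d m, In m (G (d + Datatypes.S k)) -> E k m ->
               In m (Fn (k, G k)) \/ In m (G k)).
{ intros k d m Hm Hk. induction d as [|d IH].
  - apply in_app_or in Hm. exact Hm.
  - apply in_app_or in Hm. destruct Hm as [Hm|Hm]; [|auto].
    exfalso. refine (proj1 (HF (d + Datatypes.S k, _)) m k Hm _ Hk). simpl fst. lia. }
assert (Gmono : forall k d m, In m (G k) -> In m (G (d + k))).
{ intros k d m Hm. induction d; simpl; auto using in_or_app. }
exists (fun m => exists k, In m (G k)). intros k Hk.
destruct (HF (k, G k)) as [_ H]. destruct (H Hk) as (s & Hs & Hks & Hc). simpl in Hc.
exists s; split; [auto|split; [auto|]].
eapply has_card_ext; [|exact Hc]. intros m; simpl. split.
- intros [Hm Hkm]; split; auto. exists (Datatypes.S k). simpl. apply in_or_app, Hm.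
- intros [[j Hm] Hkm]; split; auto. apply (HG k j); auto.
  rewrite Nat.add_comm. apply (Gmono j (Datatypes.S k)) in Hm. exact Hm.
Qed.

End Transversal.

Lemma finite_bounded_fibres {T : Type} (P : T -> Prop) (f : T -> nat) :
  (forall b c, P b -> P c -> f b = f c -> b = c) ->
  forall N, exists l : list T, forall b, P b -> f b < N -> In b l.
Proof.
intros Hf N. induction N as [|N [l Hl]].
- exists []. intros; lia.
- destruct (classic (exists b, P b /\ f b = N)) as [(b & Pb & Hb)|Hn].
  + exists (b :: l). intros c Pc Hc. destruct (Nat.eq_dec (f c) N).
    * left. apply Hf; congruence.
    * right. apply Hl; auto; lia.
  + exists l. intros c Pc Hc. apply Hl; auto.
    assert (f c <> N) by eauto. lia.
Qed.

Definition column (n : nat) : subset_nat := fun m => exists k, m = to_nat (n, k).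

Lemma column_infinite n : infinite_nat (column n).
Proof.
apply infinite_of_large_subsets. intros N.
exists (fun m => In m (map (fun k => to_nat (n, k)) (seq 0 N))), N.
split; [|split; [|lia]].
- intros m Hm. apply in_map_iff in Hm. destruct Hm as (k & <- & _). now exists k.
- eexists. split; [|split; [reflexivity|]].
  + apply Injective_map_NoDup, seq_NoDup.
    intros x y H%to_nat_inj. congruence.
  + now rewrite length_map, length_seq.
Qed.

Lemma column_disjoint n n' m : column n m -> column n' m -> n = n'.
Proof. intros [k ->] [k' H%to_nat_inj]. congruence. Qed.

(** The last clause strengthens the Luzin condition: an intersection contained in [n] has at most
    [n] points. Sizes, unlike bounds on elements, can be compared after an arbitrary permutation of
    omega. *)
Definition sized_Luzin (S : nat -> Prop) (I : Type) (lt : I -> I -> Prop)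
    (e : I -> subset_nat) : Prop :=
  (forall a, infinite_nat (e a)) /\
  (forall a b, a <> b -> exists s, S s /\ has_card (fun m => e a m /\ e b m) s) /\
  (forall a N, exists l : list I, forall b s, lt b a ->
     has_card (fun m => e a m /\ e b m) s -> s <= N -> In b l).

Section Recursion.

Variables (S : nat -> Prop) (I : Type) (lt : I -> I -> Prop).
Hypothesis HS : unbounded S.
Hypothesis HI : is_omega1 I lt.

Variable code : I -> I -> nat.
Hypothesis code_inj : forall a b c,
  lt b a -> lt c a -> code a b = code a c -> b = c.

(* The columns are interleaved with the sets already built so that the list to
   be diagonalised against is infinite also at finite stages; an odd entry
   without corresponding set is empty. *)
Definition stage (a : I) (prev : forall b, lt b a -> subset_nat) (k : nat) : subset_nat :=
  if Nat.even k then column (Nat.div2 k)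
  else fun m => exists b (H : lt b a), code a b = Nat.div2 k /\ prev b H m.

Variable next : (nat -> subset_nat) -> subset_nat.
Hypothesis next_spec : forall E,
  (forall j k, j <> k -> finite_nat (fun m => E j m /\ E k m)) ->
  forall k, infinite_nat (E k) ->
  exists s, S s /\ k <= s /\ has_card (fun m => next E m /\ E k m) s.

Variable e : I -> subset_nat.
Hypothesis e_eq : forall a, e a = next (stage a (fun b _ => e b)).

Lemma stage_column a prev n m : stage a prev (2 * n) m <-> column n m.
Proof.
unfold stage. rewrite Nat.even_mul. simpl orb. cbv iota.
now rewrite Nat.div2_double.
Qed.

Lemma stage_prev a b m : lt b a ->
  stage a (fun b _ => e b) (Datatypes.S (2 * code a b)) m <-> e b m.
Proof.
intros H. unfold stage. rewrite Nat.even_succ, Nat.odd_mul. simpl andb. cbv iota.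
rewrite Nat.div2_succ_double. split.
- intros (c & Hc & E & Hm). apply code_inj in E; auto. now subst.
- intros Hm. exists b, H; auto.
Qed.

Lemma stage_cases a k m : stage a (fun b _ => e b) k m ->
  (exists n, k = 2 * n /\ column n m) \/
  (exists b, lt b a /\ k = Datatypes.S (2 * code a b) /\ e b m).
Proof.
unfold stage. destruct (Nat.even k) eqn:Ek.
- intros Hm. left. exists (Nat.div2 k). split; auto.
  apply Nat.even_spec in Ek. destruct Ek as [q ->]. now rewrite Nat.div2_double.
- intros (b & Hb & E & Hm). right. exists b; repeat split; auto. rewrite E.
  assert (Ho : Nat.odd k = true) by (unfold Nat.odd; now rewrite Ek).
  apply Nat.odd_spec in Ho. destruct Ho as [q ->].
  now rewrite Nat.add_1_r, Nat.div2_succ_double.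
Qed.

(** The clause on columns is carried through the induction because it makes the list at stage [a]
    almost disjoint. Infinity of [e a] comes from the columns too: entry [2 * n] forces at least
    [2 * n] points in column [n]. The set [e b] is entry [2 * code a b + 1], whence the lower bound
    on the size. *)
Lemma stage_spec a :
  (forall n, finite_nat (fun m => e a m /\ column n m)) /\
  infinite_nat (e a) /\
  (forall b, lt b a ->
     exists s, S s /\ code a b <= s /\ has_card (fun m => e a m /\ e b m) s).
Proof.
destruct HI as (_ & _ & Htot & Hwf & _ & _).
induction (Hwf a) as [a _ IH].
set (E := stage a (fun b _ => e b)).
assert (Hfin : forall b c, lt b a -> lt c a -> b <> c ->
                 finite_nat (fun m => e b m /\ e c m)).
{ intros b c Hb Hc Hbc. destruct (Htot b c) as [H|[H|H]]; [|tauto|].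
  - destruct (IH c Hc) as (_ & _ & Hs). destruct (Hs b H) as (s & _ & _ & Hcard).
    apply has_card_finite in Hcard. eapply finite_subset; [|exact Hcard]. simpl; tauto.
  - destruct (IH b Hb) as (_ & _ & Hs). destruct (Hs c H) as (s & _ & _ & Hcard).
    now apply has_card_finite in Hcard. }
assert (HE : forall j k, j <> k -> finite_nat (fun m => E j m /\ E k m)).
(* An infinite intersection has a point, so neither entry is an empty odd one, and each is a column
   or an earlier set. *)
{ intros j k Hjk. apply NNPP; intros Hn.
  destruct (infinite_inhabited_outside _ [] Hn) as (m0 & [Hj Hk] & _).
  apply stage_cases in Hj, Hk.
  destruct Hj as [(n & -> & _)|(b & Hb & -> & _)];
  destruct Hk as [(n' & -> & _)|(c & Hc & -> & _)]; apply Hn.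
  - exists []. intros m [H1 H2]. apply stage_column in H1, H2.
    exfalso; apply Hjk. f_equal. eapply column_disjoint; eauto.
  - destruct (IH c Hc) as (Hcol & _). eapply finite_subset; [|exact (Hcol n)].
    intros m [H1 H2]. apply stage_column in H1. apply stage_prev in H2; auto.
  - destruct (IH b Hb) as (Hcol & _). eapply finite_subset; [|exact (Hcol n')].
    intros m [H1 H2]. apply stage_column in H2. apply stage_prev in H1; auto.
  - eapply finite_subset; [|apply (Hfin b c); auto; congruence].
    intros m [H1 H2]. apply stage_prev in H1, H2; auto. }
pose proof (next_spec E HE) as Hnext. unfold E in Hnext at 2. rewrite <- e_eq in Hnext.
assert (Hcol : forall n, exists s, S s /\ 2 * n <= s /\
                  has_card (fun m => e a m /\ column n m) s).
{ intros n. destruct (Hnext (2 * n)) as (s & Hs & Hns & Hc).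
  - intros H. apply (column_infinite n). eapply finite_subset; [|exact H].
    intros m Hm. now apply stage_column.
  - exists s; split; [auto|split; [auto|]]. eapply has_card_ext; [|exact Hc].
    intros m; unfold E. now rewrite stage_column. }
split; [|split].
- intros n. destruct (Hcol n) as (s & _ & _ & Hc). eapply has_card_finite; eauto.
- apply infinite_of_large_subsets. intros N. destruct (Hcol N) as (s & _ & Hn & Hc).
  exists (fun m => e a m /\ column N m), s. split; [tauto|split; [auto|lia]].
- intros b Hb. destruct (Hnext (Datatypes.S (2 * code a b))) as (s & Hs & Hns & Hc).
  + intros H. destruct (IH b Hb) as (_ & Hinf & _). apply Hinf.
    eapply finite_subset; [|exact H]. intros m Hm. now apply stage_prev.
  + exists s; split; [auto|split; [lia|]]. eapply has_card_ext; [|exact Hc].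
    intros m; unfold E. now rewrite stage_prev.
Qed.

Lemma recursion_sized_Luzin : sized_Luzin S I lt e.
Proof.
destruct HI as (_ & _ & Htot & _).
split; [|split].
- intros a. apply stage_spec.
- intros a b Hab. destruct (Htot a b) as [H|[H|H]]; [|tauto|].
  + destruct (stage_spec b) as (_ & _ & Hs). destruct (Hs a H) as (s & HSs & _ & Hc).
    exists s; split; auto. eapply has_card_ext; [|exact Hc]. simpl; tauto.
  + destruct (stage_spec a) as (_ & _ & Hs). destruct (Hs b H) as (s & HSs & _ & Hc).
    exists s; auto.
- intros a N.
  (* A size at most [N] forces [code a b <= N], and [code a] is injective below [a]. *)
  destruct (finite_bounded_fibres (fun b => lt b a) (code a) (code_inj a) (Datatypes.S N))
    as [l Hl].
  exists l. intros b s Hb Hc Hs. apply Hl; auto.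
  destruct (stage_spec a) as (_ & _ & H). destruct (H b Hb) as (s' & _ & Hs' & Hc').
  rewrite (has_card_unique _ _ _ Hc Hc') in Hs. lia.
Qed.

End Recursion.

Lemma sized_Luzin_exists S I lt : unbounded S -> is_omega1 I lt ->
  exists e, sized_Luzin S I lt e.
Proof.
intros HS HI. pose proof HI as (_ & _ & _ & Hwf & _ & Hcount).
destruct (boolp.choice Hcount) as [code Hcode].
assert (Hnext : forall E : nat -> subset_nat, exists A : subset_nat,
  (forall j k, j <> k -> finite_nat (fun m => E j m /\ E k m)) ->
  forall k, infinite_nat (E k) ->
  exists s, S s /\ k <= s /\ has_card (fun m => A m /\ E k m) s).
{ intros E.
  destruct (classic (forall j k, j <> k -> finite_nat (fun m => E j m /\ E k m))) as [HE|HE].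
  - destruct (transversal S E HS HE) as [A HA]. exists A; auto.
  (* An arbitrary value makes [next] total: the recursion must be defined before its lists are known
     to be almost disjoint. *)
  - exists (fun _ => True). tauto. }
destruct (boolp.choice Hnext) as [next Hn].
set (step := fun a prev => next (stage I lt code a prev)).
set (e := Fix Hwf (fun _ => subset_nat) step).
exists e. apply recursion_sized_Luzin with (code := code) (next := next); auto.
intros a. unfold e. rewrite Fix_eq; [reflexivity|].
intros x f g Hfg. f_equal. extensionality b. extensionality H. apply Hfg.
Qed.

Definition range {I : Type} (e : I -> subset_nat) : subset_nat -> Prop :=
  fun x => exists a, e a = x.

Lemma sized_Luzin_injective S I lt e a b :
  sized_Luzin S I lt e -> e a = e b -> a = b.
Proof.
intros (Hinf & Hsize & _) E. apply NNPP; intros Hab.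
destruct (Hsize a b Hab) as (s & _ & Hc). apply has_card_finite in Hc.
apply (Hinf a). eapply finite_subset; [|exact Hc]. rewrite E; auto.
Qed.

Lemma sized_Luzin_Luzin S I lt e :
  is_omega1 I lt -> sized_Luzin S I lt e -> Luzin (range e).
Proof.
intros HI He. pose proof He as (Hinf & Hsize & Hlow). split.
- split.
  + intros x [a <-]; auto.
  + intros x y [a <-] [b <-] Hxy. destruct (Hsize a b) as (s & _ & Hc).
    * congruence.
    * eapply has_card_finite; eauto.
- exists I, lt, e. split; [auto|split; [|split; [reflexivity|]]].
  + intros a b. now apply (sized_Luzin_injective S I lt e).
  + intros a n. destruct (Hlow a n) as [l Hl]. exists l. intros b Hb Hn.
    destruct (finite_has_card (fun m => e a m /\ e b m)) as [s Hs].
    * exists (seq 0 n). intros m [H1 H2]. apply in_seq. specialize (Hn m H1 H2). lia.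
    * apply (Hl b s); auto.
      apply (has_card_le (fun m => e a m /\ e b m) (fun m => m < n)); auto.
      -- intros m [H1 H2]; auto.
      -- apply has_card_lt.
Qed.

(** * Homeomorphisms between Psi-spaces *)

Lemma Psi_eq A (p q : Psi A) : proj1_sig p = proj1_sig q -> p = q.
Proof.
destruct p as [p Hp], q as [q Hq]; simpl. intros ->. f_equal. apply proof_irrelevance.
Qed.

Section Homeomorphism.

Variables (A B : subset_nat -> Prop) (f : Psi A -> Psi B) (g : Psi B -> Psi A).
Hypotheses (gf : forall p, g (f p) = p) (fg : forall q, f (g q) = q).

(** Pulling the open singleton of [m] back along [g] shows that the image of [m] is an isolated
    point. If it were some [y] in [B], every neighbourhood of it would contain points of omega,
    since [y] is infinite. *)
Lemma isolated_image :
  (forall y, B y -> infinite_nat y) -> Psi_continuous B A g ->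
  forall m, exists k, f (Psi_nat A m) = Psi_nat B k.
Proof.
intros HB Hg m.
destruct (proj1_sig (f (Psi_nat A m))) as [k|y] eqn:E.
- exists k. now apply Psi_eq.
- exfalso.
  assert (Hy : B y).
  { destruct (f (Psi_nat A m)) as [q Hq]; simpl in E; subst q. exact Hq. }
  assert (Hopen : Psi_open A (fun p => p = Psi_nat A m)).
  { intros p -> x Hx. discriminate Hx. }
  destruct (Hg _ Hopen (f (Psi_nat A m)) (gf _) y E) as [F HF].
  destruct (infinite_inhabited_outside y F (HB y Hy)) as (k & Hk & HkF).
  specialize (HF k Hk HkF). rewrite <- HF, fg in E. discriminate E.
Qed.

Lemma branch_almost_image (h : nat -> nat) p x y :
  Psi_continuous A B f -> (forall m, f (Psi_nat A m) = Psi_nat B (h m)) ->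
  proj1_sig p = inr x -> proj1_sig (f p) = inr y ->
  exists F : list nat, forall m, x m -> ~ In m F -> y (h m).
Proof.
intros Hf Hh Hp Hq.
(* [V] is the basic neighbourhood of [y] with nothing removed; continuity pulls it back to a
   neighbourhood of [x]. *)
set (V := fun q => q = f p \/ exists k, y k /\ q = Psi_nat B k).
assert (HV : Psi_open B V).
{ intros q [->|(k & _ & ->)] z Hz; [|discriminate Hz].
  exists []. intros m Hm _. right. exists m. split; auto. congruence. }
destruct (Hf V HV p (or_introl eq_refl) x Hp) as [F HF].
exists F. intros m Hm HmF. destruct (HF m Hm HmF) as [H|(k & Hk & H)]; rewrite Hh in H.
- rewrite <- H in Hq. discriminate Hq.
- injection H as ->. exact Hk.
Qed.

End Homeomorphism.

Lemma homeomorphic_bijection (A B : subset_nat -> Prop) :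
  (forall x, A x -> infinite_nat x) -> (forall y, B y -> infinite_nat y) ->
  Psi_homeomorphic A B ->
  exists (h k : nat -> nat) (phi : subset_nat -> subset_nat),
    (forall m, k (h m) = m) /\ (forall m, h (k m) = m) /\
    (forall x, A x -> B (phi x)) /\
    (forall x x', A x -> A x' -> phi x = phi x' -> x = x') /\
    (forall x, A x -> exists n, forall m, n <= m -> (x m <-> phi x (h m))).
Proof.
intros HA HB (f & g & gf & fg & Hf & Hg).
destruct (boolp.choice (isolated_image A B f g gf fg HB Hg)) as [h Hh].
destruct (boolp.choice (isolated_image B A g f fg gf HA Hf)) as [k Hk].
assert (kh : forall m, k (h m) = m).
{ intros m. pose proof (gf (Psi_nat A m)) as H. rewrite Hh, Hk in H. now injection H. }
assert (hk : forall m, h (k m) = m).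
{ intros m. pose proof (fg (Psi_nat B m)) as H. rewrite Hk, Hh in H. now injection H. }
assert (Hphi : forall x, exists y, A x -> B y /\
          exists p, proj1_sig p = inr x /\ proj1_sig (f p) = inr y).
{ intros x. destruct (classic (A x)) as [Ax|Nx]; [|exists x; tauto].
  set (p := exist _ (inr x) Ax : Psi A).
  destruct (proj1_sig (f p)) as [m|y] eqn:E.
  - exfalso. assert (Hp : f p = Psi_nat B m) by now apply Psi_eq.
    apply (f_equal g) in Hp. rewrite gf, Hk in Hp.
    apply (f_equal (@proj1_sig _ _)) in Hp. discriminate Hp.
  - exists y. intros _. split; [|exists p; auto].
    destruct (f p) as [q Hq]; simpl in E; subst q. exact Hq. }
destruct (boolp.choice Hphi) as [phi HP].
exists h, k, phi. split; [auto|split; [auto|split; [|split]]].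
- intros x Hx. now apply HP.
- intros x x' Hx Hx' E.
  destruct (HP x Hx) as (_ & p & Hp & Hq). destruct (HP x' Hx') as (_ & p' & Hp' & Hq').
  assert (H : f p = f p') by (apply Psi_eq; congruence).
  apply (f_equal g) in H. rewrite !gf in H. congruence.
- intros x Hx. destruct (HP x Hx) as (_ & p & Hp & Hq).
  destruct (branch_almost_image A B f h p x (phi x)) as [F HF]; auto.
  destruct (branch_almost_image B A g k (f p) (phi x) x) as [F' HF']; auto.
  { now rewrite gf. }
  (* [F] collects the exceptions for [f], and [F'] those for [g], which live in the target copy of
     omega and are brought back by [k]. *)
  exists (Datatypes.S (list_max (F ++ map k F'))). intros m Hm.
  assert (Hbig : forall z, In z (F ++ map k F') -> z < m).
  { intros z Hz. assert (Hl : list_max (F ++ map k F') <= list_max (F ++ map k F')) by lia.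
    apply list_max_le in Hl. rewrite Forall_forall in Hl. specialize (Hl z Hz). lia. }
  split.
  + intros Hxm. apply HF; auto. intros Hin.
    specialize (Hbig m (in_or_app _ _ _ (or_introl Hin))). lia.
  + intros Hym. rewrite <- (kh m). apply HF'; auto. intros Hin.
    apply (in_map k) in Hin. rewrite kh in Hin.
    specialize (Hbig m (in_or_app _ _ _ (or_intror Hin))). lia.
Qed.

(** * Distinguishing the families *)

(** Binary notation, least significant bit first, closed by a leading digit 1 so that lists
    differing only in final [false] entries get different codes. *)
Fixpoint encode (l : list bool) : nat :=
  match l with [] => 1 | b :: l => (if b then 1 else 0) + 2 * encode l end.

Lemma encode_pos l : 1 <= encode l.
Proof. induction l as [|[] l IH]; simpl; lia. Qed.

Lemma encode_inj l l' : encode l = encode l' -> l = l'.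
Proof.
revert l'. induction l as [|b l IH]; intros [|b' l']; simpl; auto.
- pose proof (encode_pos l'). destruct b'; lia.
- pose proof (encode_pos l). destruct b; lia.
- intros H. assert (b = b' /\ encode l = encode l') as [-> E] by (destruct b, b'; split; auto; lia).
  f_equal; auto.
Qed.

Lemma length_le_encode l : length l <= encode l.
Proof. induction l as [|[] l IH]; simpl; [lia|..]; pose proof (encode_pos l); lia. Qed.

Definition prefix (i : nat -> bool) (k : nat) : list bool := map i (seq 0 k).

Definition sparse (i : nat -> bool) : nat -> Prop :=
  fun s => exists k, s = 2 ^ encode (prefix i k).

Lemma sparse_unbounded i : unbounded (sparse i).
Proof.
intros N. exists (2 ^ encode (prefix i N)). split; [now exists N|].
pose proof (length_le_encode (prefix i N)) as H.
unfold prefix in H at 1. rewrite length_map, length_seq in H.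
pose proof (Nat.pow_gt_lin_r 2 (encode (prefix i N))). lia.
Qed.

Lemma prefix_agree i j k k' n :
  prefix i k = prefix j k' -> n < k -> i n = j n.
Proof.
intros E Hn.
assert (Hk : k = k').
{ apply (f_equal (@length _)) in E. unfold prefix in E. now rewrite !length_map, !length_seq in E. }
subst k'. apply (f_equal (fun l => nth_error l n)) in E. unfold prefix in E.
rewrite !nth_error_map in E.
rewrite (nth_error_nth' _ 0) in E by (rewrite length_seq; lia).
rewrite seq_nth in E by lia. simpl in E. congruence.
Qed.

Lemma pow2_lt_double p q : 2 ^ p < 2 ^ q -> 2 * 2 ^ p <= 2 ^ q.
Proof.
intros H. apply Nat.pow_lt_mono_r_iff in H; [|lia].
rewrite <- Nat.pow_succ_r'. apply Nat.pow_le_mono_r; lia.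
Qed.

(* Distinct powers of two differ by at least the smaller one. *)
Lemma sparse_almost_disjoint_shifts i j c d : i <> j ->
  exists N, forall s t, sparse i s -> sparse j t -> s + d = t + c -> s <= N.
Proof.
intros Hij.
assert (Hn : exists n, i n <> j n).
{ apply NNPP; intros H. apply Hij. extensionality n. apply NNPP; intros Hn; apply H; eauto. }
destruct Hn as [n Hn].
(* [M] bounds the elements given by prefixes of length at most [n], too short to show that [i] and
   [j] differ at [n]. *)
assert (HM : exists M, forall k, k <= n -> 2 ^ encode (prefix i k) <= M).
{ exists (list_max (map (fun k => 2 ^ encode (prefix i k)) (seq 0 (Datatypes.S n)))).
  intros k Hk.
  assert (Hl : list_max (map (fun k => 2 ^ encode (prefix i k)) (seq 0 (Datatypes.S n)))
    <= list_max (map (fun k => 2 ^ encode (prefix i k)) (seq 0 (Datatypes.S n)))) by lia.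
  apply list_max_le in Hl. rewrite Forall_forall in Hl. apply Hl.
  apply (in_map (fun k => 2 ^ encode (prefix i k))), in_seq. lia. }
destruct HM as [M HM].
(* One summand per case: [s < t] gives [2 * s <= t] and so [s <= d]; [s = t] gives [s <= M]; [t < s]
   gives [2 * t <= s] and so [s <= 2 * c]. *)
exists (M + 2 * c + d). intros s t [k ->] [k' ->] E.
destruct (lt_eq_lt_dec (2 ^ encode (prefix i k)) (2 ^ encode (prefix j k'))) as [[H|H]|H].
- apply pow2_lt_double in H. lia.
- apply Nat.pow_inj_r in H; [|lia]. apply encode_inj in H.
  destruct (le_lt_dec k n) as [Hk|Hk]; [specialize (HM k Hk); lia|].
  exfalso. apply Hn, (prefix_agree i j k k'); auto.
- apply pow2_lt_double in H. lia.
Qed.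

(** Otherwise each [a] has finitely many predecessors of its own colour, and the pair of the colour
    and their number determines [a], contradicting uncountability. Infinitely many predecessors are
    what is needed to escape the finite lists of the Luzin condition. *)
Lemma omega1_pigeonhole I (lt : I -> I -> Prop) (t : I -> nat) : is_omega1 I lt ->
  exists a, ~ exists l : list I, forall b, lt b a -> t b = t a -> In b l.
Proof.
intros (Hirr & Htr & Htot & _ & Hunc & _).
apply NNPP; intros Hn. apply Hunc.
assert (H : forall a, exists l, NoDup l /\ forall b, In b l <-> lt b a /\ t b = t a).
{ intros a. apply NNPP; intros Ha. apply Hn. exists a. intros [l Hl]. apply Ha.
  destruct (list_separation (fun b => lt b a /\ t b = t a) l) as (l' & Hnd & Hl').
  exists l'; split; auto. intros b. rewrite Hl'. split; [tauto|].
  intros [H1 H2]; auto. }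
destruct (boolp.choice H) as [L HL].
assert (Hlt : forall a b, lt a b -> t a = t b -> length (L a) < length (L b)).
{ intros a b Hab E. destruct (HL a) as [Na Ia], (HL b) as [Nb Ib].
  change (length (a :: L a) <= length (L b)). apply NoDup_incl_length.
  - constructor; auto. intros Hin. apply Ia in Hin. now apply (Hirr a).
  - intros x [<-|Hx]; apply Ib; [auto|]. apply Ia in Hx. destruct Hx as [H1 H2].
    split; [eauto|congruence]. }
exists (fun a => to_nat (t a, length (L a))). intros a b E%to_nat_inj.
injection E as E1 E2. destruct (Htot a b) as [Hab|[Hab|Hab]]; auto.
- specialize (Hlt a b Hab E1). lia.
- specialize (Hlt b a Hab (eq_sym E1)). lia.
Qed.

(** The length records [n], so equal traces also have equal bounds. *)
Definition trace (n : nat) (x : subset_nat) : list bool :=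
  map (fun m => if excluded_middle_informative (x m) then true else false) (seq 0 n).

Lemma trace_eq n n' x x' : trace n x = trace n' x' ->
  n = n' /\ forall m, m < n -> (x m <-> x' m).
Proof.
intros E.
assert (Hn : n = n').
{ apply (f_equal (@length _)) in E. unfold trace in E. now rewrite !length_map, !length_seq in E. }
subst n'. split; auto. intros m Hm.
pose proof (ext_in_map E m (proj2 (in_seq _ _ _) (conj (Nat.le_0_l _) Hm))) as H.
simpl in H. destruct (excluded_middle_informative (x m)), (excluded_middle_informative (x' m));
  tauto || discriminate.
Qed.

Lemma has_card_split (X : subset_nat) n c r :
  has_card (fun m => m < n /\ X m) c -> has_card (fun m => n <= m /\ X m) r ->
  has_card X (c + r).
Proof.
intros Hc Hr.
apply has_card_ext with (fun m => (m < n /\ X m) \/ (n <= m /\ X m)).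
- intros m. destruct (le_lt_dec n m); tauto.
- apply has_card_union; auto. intros; lia.
Qed.

Lemma has_card_below (X : subset_nat) n : exists c, has_card (fun m => m < n /\ X m) c.
Proof.
apply finite_has_card. exists (seq 0 n). intros m [Hm _]. apply in_seq; lia.
Qed.

(* On uncountably many [a] the bound [n] beyond which [h] maps [e a] onto its
   image, and the traces of both sets below [n], are constant, so the sizes of
   intersections change by the fixed amount [d - c]. *)
Lemma homeomorphic_sizes (S S' : nat -> Prop) I lt I' lt'
    (e : I -> subset_nat) (e' : I' -> subset_nat) :
  is_omega1 I lt -> sized_Luzin S I lt e -> sized_Luzin S' I' lt' e' ->
  Psi_homeomorphic (range e) (range e') ->
  exists c d, forall N, exists s s', S s /\ S' s' /\ N < s /\ s + d = s' + c.
Proof.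
intros HI He He' Hhom.
pose proof He as (Hinf & Hsize & Hlow). pose proof He' as (Hinf' & Hsize' & _).
destruct (homeomorphic_bijection (range e) (range e'))
  as (h & k & phi & kh & hk & Hphi & phi_inj & Htail); auto.
{ intros x [a <-]; auto. }
{ intros x [a <-]; auto. }
assert (Hr : forall a, range e (e a)) by (intros a; now exists a).
destruct (boolp.choice (fun a => Htail (e a) (Hr a))) as [n Hn].
(* Pulled back along [h], the image of [e a] lives in the same copy of omega as [e a] and agrees
   with it from [n a] on. *)
set (img := fun a m => phi (e a) (h m)).
set (t := fun a => to_nat (encode (trace (n a) (e a)), encode (trace (n a) (img a)))).
destruct (omega1_pigeonhole I lt t HI) as [a Ha].
(* For [b] of the same colour as [a], [e a] and [e b] coincide below [n a], so [c] counts their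
   common points there; [d] does the same for the images. Both are fixed before [N] is given. *)
destruct (has_card_below (e a) (n a)) as [c Hc].
destruct (has_card_below (img a) (n a)) as [d Hd].
exists c, d. intros N.
destruct (Hlow a N) as [l Hl].
(* The list [l] contains every [b] below [a] whose set meets [e a] in at most [N] points, and it
   cannot exhaust the predecessors of the colour of [a]. *)
assert (Hb : exists b, lt b a /\ t b = t a /\ ~ In b l).
{ apply NNPP; intros H. apply Ha. exists l. intros b H1 H2.
  apply NNPP; intros H3. apply H; eauto. }
destruct Hb as (b & Hba & Htb & Hbl).
apply to_nat_inj in Htb. injection Htb as T1 T2.
apply encode_inj, trace_eq in T1, T2. destruct T1 as [En T1], T2 as [_ T2].
rewrite En in T1, T2.
assert (Hab : a <> b).
{ intros ->. destruct HI as [Hirr _]. now apply (Hirr b). }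
destruct (Hsize a b Hab) as (s & Ss & Hs).
destruct (Hphi _ (Hr a)) as [a' Ea'], (Hphi _ (Hr b)) as [b' Eb'].
assert (Hab' : a' <> b').
{ intros H. apply Hab, (sized_Luzin_injective S I lt e); auto.
  apply phi_inj; auto. congruence. }
destruct (Hsize' a' b' Hab') as (s' & Ss' & Hs').
rewrite Ea', Eb' in Hs'.
apply (has_card_preimage h k) in Hs'; auto.
(* From [n a] on, both intersections are the same set, of size [r], hence [s = c + r] and
   [s' = d + r]. *)
destruct (finite_has_card (fun m => n a <= m /\ (e a m /\ e b m))) as [r Hrest].
{ apply has_card_finite in Hs. eapply finite_subset; [|exact Hs]. simpl; tauto. }
exists s, s'. split; [auto|split; [auto|split]].
- destruct (le_lt_dec s N) as [H|]; auto. exfalso. apply Hbl, (Hl b s); auto.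
- assert (E1 : s = c + r).
  { apply (has_card_unique _ _ _ Hs). apply has_card_split with (n a); auto.
    eapply has_card_ext; [|exact Hc]. intros m; simpl.
    split; [|tauto]. intros [H1 H2]. rewrite (T1 m H1). auto. }
  assert (E2 : s' = d + r).
  { apply (has_card_unique _ _ _ Hs'). apply has_card_split with (n a).
    - eapply has_card_ext; [|exact Hd]. intros m; simpl. unfold img in *.
      split; [|tauto]. intros [H1 H2]. rewrite (T2 m H1). auto.
    - eapply has_card_ext; [|exact Hrest]. intros m; simpl.
      split; intros [H1 H2]; (split; [auto|]).
      + now rewrite <- (Hn a), <- (Hn b) by lia.
      + now rewrite (Hn a), (Hn b) by lia. }
  lia.
Qed.

(* continuum many (indexed injectively by subsets of omega) Luzin families
   with pairwise non-homeomorphic Psi-spaces *)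
Theorem theorem13 :
  exists L : (nat -> bool) -> (subset_nat -> Prop),
    (forall i, Luzin (L i)) /\
    (forall i j, i <> j -> ~ Psi_homeomorphic (L i) (L j)).
Proof.
destruct omega1_exists as (I & lt & HI).
destruct (boolp.choice (fun i => sized_Luzin_exists (sparse i) I lt (sparse_unbounded i) HI))
  as [e He].
exists (fun i => range (e i)). split.
- intros i. eapply sized_Luzin_Luzin; eauto.
- intros i j Hij Hhom.
  destruct (homeomorphic_sizes (sparse i) (sparse j) I lt I lt (e i) (e j)) as (c & d & H); auto.
  destruct (sparse_almost_disjoint_shifts i j c d Hij) as [N HN].
  destruct (H N) as (s & s' & Hs & Hs' & Hlt & E).
  specialize (HN s s' Hs Hs' E). lia.
Qed.
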